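(* Let $n_P\ge 1$ pursuers $P_1,\dots,P_{n_P}$ and one evader $E$ evolve under the discrete linear relative-motion dynamics $\bm{x}^{(j)}_{k}=A_d\bm{x}^{(j)}_{k-1}+B_d\bm{u}^{(j)}_{k-1}$, $k=1,\dots,N$, from given initial states $\bm{x}_0^{(j)}$, with box-bounded controls $\|\bm{u}^{(j)}_k\|_\infty\le \bar u^{(j)}$, as specified in the context. Let $r_{\mathrm{cap}}>0$, let $\{\bm{d}_\ell\}_{\ell=1}^{L}\subset\mathbb{R}^2$ be any finite nonempty set of unit vectors (in the Euclidean norm), fix $i\in\{1,\dots,n_P\}$, and define $$\phi_N^{(i)}=\min_{\ell\in\{1,\dots,L\}}\Bigl[h_{P_i}(\bm{d}_\ell)-h_E(\bm{d}_\ell)+r_{\mathrm{cap}}\Bigr],$$ where $h_j(\bm{d})$ is the terminal-position support function of agent $j$, i.e. the maximum of $\bm{d}^\top\bm{r}^{(j)}_N$ over all admissible control sequences of agent $j$. If $\phi_N^{(i)}<0$, then there exists an admissible open-loop control sequence of the evader such that, for every admissible control sequence of pursuer $i$, the terminal positions satisfy $$\bigl\|\bm{r}_N^{(P_i)}-\bm{r}_N^{(E)}\bigr\|_2\ \ge\ r_{\mathrm{cap}}-\phi_N^{(i)}\ >\ r_{\mathrm{cap}} .$$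
   Context: Dynamics (planar Hill--Clohessy--Wiltshire model). The state is $\bm{x}=[x,y,\dot x,\dot y]^\top\in\mathbb{R}^4$, the control is an acceleration $\bm{u}=[u_x,u_y]^\top\in\mathbb{R}^2$, and the position is $\bm{r}=[x,y]^\top\in\mathbb{R}^2$. The continuous-time system $\dot{\bm{x}}=A_c\bm{x}+B_c\bm{u}$ is $\ddot x-2n\dot y-3n^2x=u_x$, $\ddot y+2n\dot x=u_y$, with mean motion $n>0$. For a timestep $\Delta t>0$, the matrices $A_d\in\mathbb{R}^{4\times4}$, $B_d\in\mathbb{R}^{4\times2}$ are the zero-order-hold discretization, i.e. $\exp\!\left(\begin{bmatrix}A_c&B_c\\0&0\end{bmatrix}\Delta t\right)=\begin{bmatrix}A_d&B_d\\0&I\end{bmatrix}$. Agents and controls. The agents are $j\in\{P_1,\dots,P_{n_P},E\}$. Each agent $j$ has a given initial state $\bm{x}^{(j)}_0$ and evolves by $\bm{x}^{(j)}_{k}=A_d\bm{x}^{(j)}_{k-1}+B_d\bm{u}^{(j)}_{k-1}$ for $k=1,\dots,N$, where $N\ge1$ is the horizon; $\bm{r}_k^{(j)}$ is the position part of $\bm{x}_k^{(j)}$. A control sequence $(\bm{u}^{(j)}_0,\dots,\bm{u}^{(j)}_{N-1})$ is admissible if $\|\bm{u}^{(j)}_k\|_\infty\le\bar u^{(j)}$ for all $k$, where $\bar u^{(P_i)}=\bar u_P$ for every pursuer, $\bar u^{(E)}=\bar u_E$, and $\bar u_P>\bar u_E>0$. Open-loop means that the whole sequence is fixed at $k=0$,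 independently of the opponent's choice. Support function. For agent $j$ and $\bm{d}\in\mathbb{R}^2$, $h_j(\bm{d})=\max\{\bm{d}^\top\bm{r}_N^{(j)}\}$ over the (compact, convex) set of terminal positions reachable by admissible control sequences of agent $j$ from $\bm{x}_0^{(j)}$. *)

(* Defs.v *)
From HB Require Import structures.
From mathcomp Require Import all_boot all_order all_algebra.
From mathcomp Require Import all_classical all_reals all_analysis.
From mathcomp Require Import ring.

Set Implicit Arguments.
Unset Strict Implicit.
Unset Printing Implicit Defensive.

Import Order.TTheory GRing.Theory Num.Theory numFieldNormedType.Exports.
Local Open Scope classical_set_scope.
Local Open Scope ring_scope.

(* Makes ['M[R]_(m, n)] a [completeNormedModType], as [normed_cvg] requires. *)
HB.instance Definition _ (R : realType) (m n : nat) :=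
  Complete.on 'M[R]_(m, n).

Section MatrixExponential.
Context {R : realType}.

Definition expm_coeff n (M : 'M[R]_n) : nat -> 'M[R]_n :=
  fun k => (k`!%:R)^-1 *: M ^+ k.

Definition expm n (M : 'M[R]_n) : 'M[R]_n := limn (series (expm_coeff M)).

Lemma mx_entry_le m n (M : 'M[R]_(m, n)) i j : `|M i j| <= `|M|.
Proof.
by rewrite [leRHS]/Num.Def.normr /= mx_normrE; apply: (le_bigmax _ _ (i, j)).
Qed.

Lemma mx_norm_le m n (M : 'M[R]_(m, n)) (e : R) :
  0 <= e -> (`|M| <= e) <-> (forall i j, `|M i j| <= e).
Proof.
move=> e0; split=> [Me i j|Me]; first exact: le_trans (mx_entry_le _ _ _) Me.
by rewrite [leLHS]/Num.Def.normr /= mx_normrE; apply: bigmax_le.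
Qed.

Lemma mx_norm_mulmx m n p (M : 'M[R]_(m, n)) (N : 'M[R]_(n, p)) :
  `|M *m N| <= n%:R * `|M| * `|N|.
Proof.
apply/mx_norm_le => [|i j]; first by rewrite !mulr_ge0.
rewrite mxE (le_trans (ler_norm_sum _ _ _))//.
rewrite -mulrA mulr_natl.
have -> : `|M| * `|N| *+ n = \sum_(k < n) `|M| * `|N|.
  by rewrite sumr_const card_ord.
rewrite ler_sum// => k _.
by rewrite normrM ler_pM ?mx_entry_le.
Qed.

Lemma is_cvg_expm n (M : 'M[R]_n) : cvgn (series (expm_coeff M)).
Proof.
have MX k : `|M ^+ k| <= (`|1%:M : 'M[R]_n|) * (n%:R * `|M|) ^+ k.
  elim: k => [|k IH]; first by rewrite !expr0 mulr1.
  rewrite exprS (le_trans (mx_norm_mulmx _ _))// exprS mulrCA.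
  by rewrite ler_wpM2l// mulr_ge0.
apply: normed_cvg.
apply: (@series_le_cvg _ _
  (fun k => `|1%:M : 'M[R]_n| * exp_coeff (n%:R * `|M|) k)).
- by move=> k; exact: normr_ge0.
- by move=> k; rewrite mulr_ge0// exp_coeff_ge0// mulr_ge0.
- move=> k; rewrite /= /expm_coeff mx_normZ ger0_norm ?invr_ge0//.
  by rewrite /exp_coeff /= mulrA [leRHS]mulrC ler_wpM2l ?invr_ge0.
- exact: is_cvg_seriesZ (is_cvg_series_exp_coeff _).
Qed.

End MatrixExponential.

Section HillClohessyWiltshire.
Context {R : realType}.

(* State ordering: (x, y, x', y'). *)
Definition hcw_A (n : R) : 'M[R]_4 :=
  \matrix_(i < 4, j < 4)
    nth 0 (nth [::] [:: [:: 0;              0; 1;           0];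
                        [:: 0;              0; 0;           1];
                        [:: 3 * n ^+ 2;     0; 0;           2 * n];
                        [:: 0;              0; - (2 * n); 0]] i) j.

Definition hcw_B : 'M[R]_(4, 2) :=
  \matrix_(i < 4, j < 2)
    nth 0 (nth [::] [:: [:: 0; 0];
                        [:: 0; 0];
                        [:: 1; 0];
                        [:: 0; 1]] i) j.

(* Zero-order hold: the exponential of the augmented matrix is the block matrix
   [[A_d, B_d], [0, I]], see [zoh_expE]. *)
Definition zoh_exp (n dt : R) : 'M[R]_(4 + 2) :=
  expm (dt *: block_mx (hcw_A n) hcw_B 0 0).

Definition zoh_A (n dt : R) : 'M[R]_4 := ulsubmx (zoh_exp n dt).

Definition zoh_B (n dt : R) : 'M[R]_(4, 2) := ursubmx (zoh_exp n dt).

(* The equations x'' - 2 n y' - 3 n^2 x = u_x and y'' + 2 n x' = u_y. *)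
Lemma hcwE (n : R) (x : 'cV[R]_4) (u : 'cV[R]_2)
    (a := hcw_A n *m x + hcw_B *m u) :
  [/\ a 0 0 = x 2%:R 0, a 1 0 = x 3%:R 0,
      a 2%:R 0 - 2 * n * x 3%:R 0 - 3 * n ^+ 2 * x 0 0 = u 0 0 &
      a 3%:R 0 + 2 * n * x 2%:R 0 = u 1 0].
Proof.
rewrite /a !mxE !big_ord_recl !big_ord0 !mxE /=.
rewrite !mul0r !mul1r !addr0 !add0r.
have -> : 2%:R = lift ord0 (lift ord0 ord0) :> 'I_4 by apply: val_inj.
have -> : 3%:R = lift ord0 (lift ord0 (lift ord0 ord0)) :> 'I_4.
  by apply: val_inj.
have -> : 1 = lift ord0 ord0 :> 'I_2 by apply: val_inj.
by split=> //; rewrite -?[ord0 in LHS]/0; ring.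
Qed.

Lemma zoh_expE (n dt : R) :
  zoh_exp n dt = block_mx (zoh_A n dt) (zoh_B n dt) 0 1%:M.
Proof.
pose M : 'M[R]_(4 + 2) := dt *: block_mx (hcw_A n) hcw_B 0 0.
have MS k : dsubmx (M ^+ k.+1 : 'M[R]_(4 + 2)) = 0 :> 'M[R]_(2, 4 + 2).
  rewrite exprS -mul_dsub_mx /M linearZ /=.
  by rewrite /block_mx col_mxKd row_mx0 scaler0 mul0mx.
have S k : dsubmx (series (expm_coeff M) k.+1 : 'M[R]_(4 + 2)) =
           row_mx 0 1%:M :> 'M[R]_(2, 4 + 2).
  rewrite /series /= linear_sum /= big_nat_recl//= big1 ?addr0.
    rewrite /expm_coeff fact0 invr1 scale1r expr0.
    by rewrite -[1]/(1%:M) scalar_mx_block /block_mx col_mxKd.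
  by move=> i _; rewrite /expm_coeff linearZ /= MS scaler0.
rewrite -[LHS]submxK /zoh_A /zoh_B.
suff D : dsubmx (zoh_exp n dt) = row_mx 0 1%:M.
  by rewrite /dlsubmx /drsubmx D row_mxKl row_mxKr.
apply/matrixP => i j; rewrite -(S 0%N) mxE /zoh_exp /expm -/M [RHS]mxE.
have cE : (series (expm_coeff M) k (rshift 4 i) j : R) @[k --> \oo] -->
    limn (series (expm_coeff M)) (rshift 4 i) j.
  apply: (@continuous_cvg _ _ _ (\oo) _ _ (fun A : 'M[R]_(4 + 2) => A _ _)).
    exact: coord_continuous.
  exact: is_cvg_expm.
apply: (@cvg_unique _ _ _ _ _ _ cE); first exact: norm_hausdorff.
rewrite /= -(cvg_shiftS (fun k => series (expm_coeff M) k (rshift 4 i) j)).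
apply: cvg_near_cst; near=> k.
have := congr1 (fun A : 'M[R]_(2, 4 + 2) => A i j) (S k).
by rewrite /= mxE => ->; rewrite -(S 0%N) mxE.
Unshelve. all: by end_near. Qed.

Definition position (x : 'cV[R]_4) : 'cV[R]_2 := @usubmx R 2 2 1 x.

End HillClohessyWiltshire.

Section Game.
Context {R : realType}.

Fixpoint state (A : 'M[R]_4) (B : 'M[R]_(4, 2)) (x0 : 'cV[R]_4)
    (u : nat -> 'cV[R]_2) (k : nat) : 'cV[R]_4 :=
  if k is k'.+1 then A *m state A B x0 u k' + B *m u k' else x0.

(* [`|u k|] is the norm of ['cV[R]_2], i.e. the sup-norm.  The values of [u]
   from index [N] on are unconstrained and irrelevant to [state] up to [N]. *)
Definition admissible (N : nat) (ubar : R) (u : nat -> 'cV[R]_2) : Prop :=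
  forall k, (k < N)%N -> `|u k| <= ubar.

Definition dotv n (a b : 'cV[R]_n) : R := (a^T *m b) 0 0.

Definition norm2 n (v : 'cV[R]_n) : R := Num.sqrt (dotv v v).

Definition terminal_position (n dt : R) (N : nat) (x0 : 'cV[R]_4)
    (u : nat -> 'cV[R]_2) : 'cV[R]_2 :=
  position (state (zoh_A n dt) (zoh_B n dt) x0 u N).

(* The supremum is a maximum when [0 <= ubar]: see [support_attained]. *)
Definition support (n dt : R) (N : nat) (x0 : 'cV[R]_4) (ubar : R)
    (d : 'cV[R]_2) : R :=
  sup [set dotv d (terminal_position n dt N x0 u) | u in admissible N ubar].

Definition capture_margin (n dt : R) (N : nat) (xP xE : 'cV[R]_4)
    (ubarP ubarE rcap : R) (L : nat) (d : 'I_L.+1 -> 'cV[R]_2) : R :=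
  let gap l :=
    support n dt N xP ubarP (d l) - support n dt N xE ubarE (d l) + rcap in
  \big[Num.min/gap ord0]_(l < L.+1) gap l.

Lemma eq_state A B x0 u v N : (forall k, (k < N)%N -> u k = v k) ->
  state A B x0 u N = state A B x0 v N.
Proof.
elim: N => //= N IH uv; rewrite uv// IH// => k kN.
by apply: uv; exact: ltnW.
Qed.

Lemma linear_maximizer A B x0 (N : nat) (ubar : R) (p : 'rV[R]_4) :
  0 <= ubar ->
  exists2 u, admissible N ubar u & forall v, admissible N ubar v ->
    (p *m state A B x0 v N) 0 0 <= (p *m state A B x0 u N) 0 0.
Proof.
move=> ub0; elim: N p => [|N IH] p; first by exists (fun=> 0).
have [u uN umax] := IH (p *m A).
pose b := p *m B.
pose w k : 'cV[R]_2 :=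
  if k == N then \col_j (ubar * Num.sg (b 0 j)) else u k.
have wu k : (k < N)%N -> w k = u k by move=> kN; rewrite /w ltn_eqF.
exists w => [k|v vN].
  rewrite ltnS leq_eqVlt => /predU1P[->|kN]; last by rewrite wu// uN.
  rewrite /w eqxx; apply/mx_norm_le => // i j.
  rewrite mxE normrM (ger0_norm ub0) normr_sg.
  by rewrite ler_piMr// lern1 leq_b1.
rewrite /= !mulmxDr !mulmxA [leLHS]mxE [leRHS]mxE lerD//.
  by rewrite (eq_state _ _ _ wu) umax// => k /ltnW; exact: vN.
rewrite -/b [leLHS]mxE [leRHS]mxE ler_sum// => j _.
rewrite /w eqxx mxE mulrCA [b 0 j * Num.sg _]mulrC -normrEsg.
rewrite (le_trans (ler_norm _))// normrM mulrC ler_wpM2r//.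
exact: le_trans (mx_entry_le _ _ _) (vN _ (ltnSn _)).
Qed.

Lemma support_attained n dt N x0 (ubar : R) d : 0 <= ubar ->
  exists2 u, admissible N ubar u &
    support n dt N x0 ubar d = dotv d (terminal_position n dt N x0 u) /\
    forall v, admissible N ubar v ->
      dotv d (terminal_position n dt N x0 v) <= support n dt N x0 ubar d.
Proof.
move=> ub0; pose p : 'rV[R]_4 := @row_mx R 1 2 2 d^T 0.
have dE v : dotv d (terminal_position n dt N x0 v) =
    (p *m state (zoh_A n dt) (zoh_B n dt) x0 v N) 0 0.
  rewrite /dotv /terminal_position /position /p.
  set y := state _ _ _ _ _.
  rewrite -[y in RHS](@vsubmxK R 2 2 1) (@mul_row_col R 1 2 2 1).
  by rewrite mul0mx addr0.
have [u uN umax] := linear_maximizer (zoh_A n dt) (zoh_B n dt) x0 N p ub0.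
have sE : support n dt N x0 ubar d = dotv d (terminal_position n dt N x0 u).
  apply/eqP; rewrite eq_le; apply/andP; split.
    apply: ge_sup; first by exists (dotv d (terminal_position n dt N x0 u)), u.
    by move=> _ [v vN <-]; rewrite !dE umax.
  apply: ub_le_sup; last by exists u.
  exists (dotv d (terminal_position n dt N x0 u)) => _ [v vN <-].
  by rewrite !dE umax.
by exists u => //; split=> // v vN; rewrite sE !dE umax.
Qed.

End Game.

(* Main.v *)
(* In a direction d attaining the minimum, the evader plays the open-loop
   control maximizing its own displacement along d; every terminal position of
   the pursuer then trails it by at least h_E(d) - h_P(d) = rcap - phi along
   the unit vector d, hence in Euclidean norm. *)
Require Import Defs.
From HB Require Import structures.
From mathcomp Require Import all_boot all_order all_algebra.
From mathcomp Require Import all_classical all_reals all_analysis.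
From mathcomp Require Import ring.
Import Order.TTheory GRing.Theory Num.Theory numFieldNormedType.Exports.
Local Open Scope classical_set_scope.
Local Open Scope ring_scope.

Lemma dotvE {R : realType} {m} (a b : 'cV[R]_m) :
  dotv a b = \sum_k a k 0 * b k 0.
Proof. by rewrite /dotv mxE; apply: eq_bigr => k _; rewrite mxE. Qed.

Lemma dotv_ge0 {R : realType} {m} (a : 'cV[R]_m) : 0 <= dotv a a.
Proof. by rewrite dotvE sumr_ge0// => k _; rewrite -expr2 sqr_ge0. Qed.

Lemma dotvBr {R : realType} {m} (a b c : 'cV[R]_m) :
  dotv a (b - c) = dotv a b - dotv a c.
Proof. by rewrite /dotv mulmxBr !mxE. Qed.

Lemma norm2B {R : realType} {m} (a b : 'cV[R]_m) :
  norm2 (a - b) = norm2 (b - a).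
Proof.
rewrite /norm2 !dotvE; congr Num.sqrt.
by apply: eq_bigr => k _; rewrite -!expr2 !mxE -opprB sqrrN.
Qed.

(** Cauchy-Schwarz for a unit [d]: the residual of [v] after projection onto [d] has squared norm
    [dotv v v - dotv d v ^+ 2], which is therefore nonnegative. *)
Lemma dotv_unit_le {R : realType} {m} (d v : 'cV[R]_m) :
  norm2 d = 1 -> dotv d v <= norm2 v.
Proof.
move=> d1.
have dd : dotv d d = 1.
  by rewrite -(sqr_sqrtr (dotv_ge0 d)) -/(norm2 d) d1 expr1n.
have E : dotv (v - dotv d v *: d) (v - dotv d v *: d) =
    dotv v v - dotv d v ^+ 2.
  set c := dotv d v.
  (* Writing [c ^+ 2] as [2 c^2 - c^2 * dotv d d] turns both sides into sums over coordinates that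
     agree term by term. *)
  have -> : dotv v v - c ^+ 2 =
      dotv v v - (c * dotv d v *+ 2) + c ^+ 2 * dotv d d.
    by rewrite dd -/c; ring.
  rewrite !dotvE !mulr_sumr -sumrMnl -sumrB -big_split /=.
  by apply: eq_bigr => k _; rewrite !mxE; ring.
rewrite (le_trans (ler_norm _))// -sqrtr_sqr ler_wsqrtr//.
by rewrite -subr_ge0 -E dotv_ge0.
Qed.

Lemma capture_margin_attained {R : realType} (n dt : R) (N : nat)
    (xP xE : 'cV[R]_4) (ubarP ubarE rcap : R) {L : nat}
    (d : 'I_L.+1 -> 'cV[R]_2) :
  exists l, capture_margin n dt N xP xE ubarP ubarE rcap d =
    Defs.support n dt N xP ubarP (d l) - Defs.support n dt N xE ubarE (d l)
    + rcap.
Proof.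
rewrite /capture_margin; elim/big_ind: _ => [|x y [k ->] [l ->]|l _].
(* The seed of the iterated minimum is itself a gap, and [Num.min] always returns one of its
   arguments. *)
- by exists ord0.
- by rewrite /Num.min; case: ifP => _; [exists k|exists l].
- by exists l.
Qed.

Theorem theorem1 (R : realType) (n dt : R) (N nP L : nat)
    (ubarP ubarE rcap : R)
    (xP : 'I_nP -> 'cV[R]_4) (xE : 'cV[R]_4)
    (d : 'I_L.+1 -> 'cV[R]_2) (i : 'I_nP)
    (hn : 0 < n) (hdt : 0 < dt) (hN : (1 <= N)%N) (hnP : (1 <= nP)%N)
    (hubarE : 0 < ubarE) (hubarP : ubarE < ubarP) (hrcap : 0 < rcap)
    (hd : forall l, norm2 (d l) = 1) :
  let phi := capture_margin n dt N (xP i) xE ubarP ubarE rcap d in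
  phi < 0 ->
  exists uE : nat -> 'cV[R]_2, admissible N ubarE uE /\
    forall uP : nat -> 'cV[R]_2, admissible N ubarP uP ->
      rcap - phi <=
        norm2 (terminal_position n dt N (xP i) uP
               - terminal_position n dt N xE uE)
      /\ rcap < rcap - phi.
Proof.
move=> phi phi_lt0.
have [l phiE] := capture_margin_attained n dt N (xP i) xE ubarP ubarE rcap d.
have [uE uE_adm [hE _]] := support_attained n dt N xE (d l) (ltW hubarE).
(* The evader commits to a maximizer; for the pursuer, the bound over all its controls is what is
   kept. *)
have [_ _ [_ hP]] :=
  support_attained n dt N (xP i) (d l) (ltW (lt_trans hubarE hubarP)).
exists uE; split=> // uP uP_adm; split; last by rewrite ltrDl oppr_gt0.
(* The difference is reversed to evader minus pursuer, whose component along [d l] is the one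
   bounded below. *)
rewrite norm2B (le_trans _ (dotv_unit_le _ _ (hd l)))// dotvBr -hE.
have -> : rcap - phi =
    Defs.support n dt N xE ubarE (d l) - Defs.support n dt N (xP i) ubarP (d l).
  by rewrite /phi phiE; ring.
by rewrite lerB// hP.
Qed.
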